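(* Let $\mathcal{G}=(\mathcal{V},\mathcal{E})$ be a connected undirected graph with $n$ vertices, let $H$ be a subgroup of $\mathrm{Aut}(\mathcal{G})$, and let $T$ be the coordinate transformation matrix whose columns are a symmetry-adapted basis for the natural representation of $H$. Suppose a Markov chain $P$ defined on the graph has the symmetry of $H$. Then the matrix $T^{T}(1/n)\mathbf{1}\mathbf{1}^{T}T$ has the same block diagonal form as $T^{T}PT$. Moreover, there is only one nonzero block. Without loss of generality, let this nonzero block be $J_1$ and the corresponding block of $T^{T}PT$ be $B_1$. These two blocks relate to the orbit chain $P_H$ by $$B_1=\Pi^{1/2}P_H\Pi^{-1/2},\qquad J_1=qq^T,$$ where $\Pi=\mathrm{Diag}(\pi_H)$, $q=\sqrt{\pi_H}$ (entrywise square root), and $\pi_H$ is the stationary distribution of $P_H$.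
   Context: The vertex set is $\mathcal{V}=\{1,\ldots,n\}$, and $\mathbf{1}$ is the all-ones vector. $\mathrm{Aut}(\mathcal{G})$ is the group of permutations $\sigma$ of $\mathcal{V}$ such that $\{i,j\}\in\mathcal{E}$ if and only if $\{\sigma(i),\sigma(j)\}\in\mathcal{E}$. A Markov chain on $\mathcal{G}$ means a transition probability matrix $P\in\mathbb{R}^{n\times n}$ with $P\ge 0$ elementwise, $P\mathbf{1}=\mathbf{1}$, $P=P^T$, and $P_{ij}=0$ for $i\ne j$, $\{i,j\}\notin\mathcal{E}$; the uniform distribution is stationary for it. The natural representation of $H$ assigns to $\sigma\in H$ the $n\times n$ permutation matrix $Q(\sigma)$ with $Q_{ij}(\sigma)=1$ if $i=\sigma(j)$ and $0$ otherwise. $P$ has the symmetry of $H$ if $Q(\sigma)P=PQ(\sigma)$ for all $\sigma\in H$. Symmetry-adapted basis and block form: let $\vartheta_1,\ldots,\vartheta_h$ be the inequivalent irreducible representations of $H$, of dimensions $n_1,\ldots,n_h$, and let $m_i$ be the multiplicity of $\vartheta_i$ in the natural representation. Then $\mathbb{C}^n=V_1\oplus\cdots\oplus V_h$ (isotypic components), with $V_i=V_i^1\oplus\cdots\oplus V_i^{m_i}$, where each $V_i^j$ is an $H$-invariant subspace of dimension $n_i$ transforming according to $\vartheta_i$. A basis of this decomposition transforming with respect to the matrices $\vartheta_i(g)$, $g\in H$, is called symmetry-adapted, and $T$ is the matrix collecting the basis vectors as columns. Since the natural representation is orthogonal, $T$ is chosen to be orthogonal, so $T^{-1}=T^T$ (for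 complex matrices, $T$ is unitary and $T^T$ is read as the conjugate transpose). With the columns suitably ordered, by Schur's lemma, if $P$ has the symmetry of $H$ then $T^{T}PT$ is block diagonal with one block $P_i$ of size $m_in_i$ for each isotypic component, and $P_i$ is itself block diagonal with $n_i$ equal diagonal blocks $B_i$ of size $m_i\times m_i$. This is the block diagonal form referred to. Orbit chain: $\mathcal{V}$ is the disjoint union of the $H$-orbits. $P_H$ is the matrix indexed by the $H$-orbits with $P_H(O,O')=\sum_{u\in O'}P_{vu}$ for any $v\in O$ (independent of the choice of $v\in O$). Its stationary distribution is $\pi_H(O)=\sum_{v\in O}1/n=|O|/n$.
   Formalization: The formulas for B_1 and J_1 fail for a general symmetry-adapted T (e.g. H trivial, any orthogonal T); they are proved when T uses the normalized orbit indicators as basis of the trivial component, and for arbitrary T after a unitary change of basis of that component. *)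

(* Defs.v *)
(* MathComp, with the reals as an arbitrary realType R and the complex numbers
   as R[i] (complex R, from mathcomp-real-closed). *)
From HB Require Import structures.
From mathcomp Require Import all_boot all_order all_algebra all_fingroup.
From mathcomp Require Import mxrepresentation.
From mathcomp Require Import reals.
From mathcomp Require Import complex.

Set Implicit Arguments.
Unset Strict Implicit.
Unset Printing Implicit Defensive.

Import Order.TTheory GRing.Theory Num.Theory.
Local Open Scope ring_scope.

(* An undirected graph is a symmetric relation; loops are neither required nor
   forbidden, since no condition below depends on them. *)
Definition Aut_graph n (e : rel 'I_n) : {set 'S_n} :=
  [set s : 'S_n | [forall i, forall j, e (s i) (s j) == e i j]].

Definition markov_chain_on (R : realType) n (e : rel 'I_n) (P : 'M[R]_n) : Prop :=
  [/\ forall i j, 0 <= P i j,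
      P *m const_mx 1 = const_mx 1 :> 'cV[R]_n,
      P = P^T
    & forall i j, i != j -> ~~ e i j -> P i j = 0].

(* The product of 'S_n is (s * t) x = t (s x), hence Q (s * t) = Q t *m Q s:
   Q is multiplicative for the composition s \o t = t * s.  It is the
   transpose of perm_mx s. *)
Definition natural_mx (K : pzSemiRingType) n (s : 'S_n) : 'M[K]_n :=
  \matrix_(i, j) (i == s j)%:R.

Definition has_symmetry (R : realType) n (H : {set 'S_n}) (P : 'M[R]_n) : Prop :=
  {in H, forall s, natural_mx R s *m P = P *m natural_mx R s}.

Definition complete_irreps (K : fieldType) (gT : finGroupType) (H : {group gT})
    h (d : 'I_h -> nat) (rho : forall i, mx_representation K H (d i)) : Prop :=
  [/\ forall i, mx_irreducible (rho i),
      forall i j, mx_rsim (rho i) (rho j) -> i = j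
    & forall k (rG : mx_representation K H k),
        mx_irreducible rG -> exists i, mx_rsim rG (rho i)].

Definition adjmx (R : realType) p q (A : 'M[R[i]]_(p, q)) : 'M[R[i]]_(q, p) :=
  map_mx (@Num.conj R[i]) A^T.

Definition cmx (R : realType) p q (A : 'M[R]_(p, q)) : 'M[R[i]]_(p, q) :=
  map_mx (real_complex R) A.

(* One block for each i, itself consisting of d i equal diagonal blocks B i of
   size m i.  A column index is thus a triple (i, k, j) with i : 'I_h,
   k : 'I_(d i), j : 'I_(m i), in lexicographic order. *)
Definition block_form (K : nmodType) h (d m : 'I_h -> nat)
    (B : forall i, 'M[K]_(m i)) : 'M[K]_(\sum_i \sum_(k < d i) m i) :=
  \mxdiag_i \mxdiag_(k < d i) B i.
Arguments block_form {K h} d {m} B.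

(* rho i s^-1 is the i-th irreducible representation made multiplicative for
   composition, like natural_mx; block i below is its Kronecker product with
   the identity of size m i. *)
Definition irreps_mx (K : fieldType) n (H : {group 'S_n})
    h (d : 'I_h -> nat) (rho : forall i, mx_representation K H (d i))
    (m : 'I_h -> nat) (s : 'S_n) : 'M[K]_(\sum_i \sum_(k < d i) m i) :=
  \mxdiag_i \mxblock_(l < d i, k < d i) ((rho i s^-1%g l k)%:M : 'M[K]_(m i)).

(* Column (i, k, j) of T is the k-th basis vector e_k of V_i^j, and the last
   condition reads Q(s) e_k = \sum_l theta_i(s)_(l, k) e_l.  As T is
   invertible, m i is the multiplicity of rho i in the natural representation;
   it may be 0. *)
Definition symmetry_adapted (R : realType) n (H : {group 'S_n})
    h (d : 'I_h -> nat) (rho : forall i, mx_representation R[i] H (d i))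
    (m : 'I_h -> nat) (T : 'M[R[i]]_(n, \sum_i \sum_(k < d i) m i)) : Prop :=
  [/\ adjmx T *m T = 1%:M,
      T *m adjmx T = 1%:M
    & {in H, forall s,
        natural_mx R[i] s *m T = T *m irreps_mx rho m s}].

(* The columns (i, k, _) of T. *)
Definition basis_cols (K : Type) n h (d m : 'I_h -> nat)
    (T : 'M[K]_(n, \sum_i \sum_(k < d i) m i)) (i : 'I_h) (k : 'I_(d i)) :
    'M[K]_(n, m i) :=
  submxrow (submxrow T i) k.

Definition orbits n (H : {set 'S_n}) : {set {set 'I_n}} :=
  [set orbit 'P H x | x in [set: 'I_n]].

Definition orbit_at n (H : {set 'S_n}) (a : 'I_#|orbits H|) : {set 'I_n} :=
  enum_val a.

(* The value for one vertex v of O; orbit_sumE shows that the choice of v is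
   irrelevant, and the default 0 is never used on an orbit. *)
Definition orbit_sum (R : realType) n (P : 'M[R]_n) (O O' : {set 'I_n}) : R :=
  if [pick v in O] is Some v then \sum_(u in O') P v u else 0.

Definition orbit_chain (R : realType) n (H : {set 'S_n}) (P : 'M[R]_n) :
    'M[R]_#|orbits H| :=
  \matrix_(a, b) orbit_sum P (orbit_at a) (orbit_at b).

Definition orbit_dist (R : realType) n (H : {set 'S_n}) : 'rV[R]_#|orbits H| :=
  \row_a \sum_(v in orbit_at a) n%:R^-1.

Definition Pi_sqrt (R : realType) n (H : {set 'S_n}) : 'M[R]_#|orbits H| :=
  diag_mx (map_mx Num.sqrt (orbit_dist R H)).

Definition sqrt_dist (R : realType) n (H : {set 'S_n}) : 'cV[R]_#|orbits H| :=
  (map_mx Num.sqrt (orbit_dist R H))^T.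

(* Columns: the normalized indicator vectors of the orbits. *)
Definition orbit_basis (R : realType) n (H : {set 'S_n}) :
    'M[R]_(n, #|orbits H|) :=
  \matrix_(v, a) ((v \in orbit_at a)%:R / Num.sqrt #|orbit_at a|%:R).

Lemma symmetryE (R : realType) n (H : {group 'S_n}) (P : 'M[R]_n) s i j :
  has_symmetry H P -> s \in H -> P (s i) (s j) = P i j.
Proof.
move=> symP sH; have /matrixP/(_ (s i) j) := symP s sH.
rewrite !mxE (bigD1 i) //= mxE eqxx mul1r big1 ?addr0; last first.
  by move=> k ki; rewrite mxE (inj_eq perm_inj) eq_sym (negbTE ki) mul0r.
rewrite (bigD1 (s j)) //= mxE eqxx mulr1 big1 ?addr0; first by [].
by move=> k ki; rewrite mxE (negbTE ki) mulr0.
Qed.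

Lemma orbit_sumE (R : realType) n (H : {group 'S_n}) (P : 'M[R]_n)
    (O O' : {set 'I_n}) (v : 'I_n) :
  has_symmetry H P -> O \in orbits H -> O' \in orbits H -> v \in O ->
  orbit_sum P O O' = \sum_(u in O') P v u.
Proof.
move=> symP /imsetP[x _ ->] /imsetP[y _ ->] xv.
rewrite /orbit_sum; case: pickP => [w xw|/(_ v)]; last by rewrite xv.
have /orbitP[s sH <-] : v \in orbit 'P H w.
  have /orbitP[a aH <-] := xw; have /orbitP[b bH <-] := xv.
  apply/orbitP; exists (a^-1 * b)%g; first by rewrite groupM ?groupV.
  by rewrite /= !apermE permM permK.
rewrite [RHS](reindex_inj (@perm_inj _ s)) /=; apply: eq_big => [u|u _].
  apply/orbitP/orbitP => -[t tH tE].
    by exists (t * s)%g; rewrite ?groupM //= -tE /= !apermE permM.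
  exists (t * s^-1)%g; first by rewrite groupM ?groupV.
  by move: tE; rewrite /= !apermE permM => ->; rewrite permK.
by rewrite (symmetryE _ _ symP sH).
Qed.

Lemma orbit_dist_stationary (R : realType) n (H : {group 'S_n})
    (e : rel 'I_n) (P : 'M[R]_n) :
  markov_chain_on e P -> has_symmetry H P ->
  orbit_dist R H *m orbit_chain H P = orbit_dist R H.
Proof.
move=> [_ P1 PT _] symP; apply/rowP => b; rewrite !mxE.
have orbP (a : 'I_#|orbits H|) : orbit_at a \in orbits H by apply: enum_valP.
pose F v : R := n%:R^-1 * \sum_(u in orbit_at b) P v u.
transitivity (\sum_(v in [set: 'I_n]) F v).
  have partH : partition (orbits H) [set: 'I_n].
    by apply: orbit_partition; apply/actsP => s _ x; rewrite !inE.
  rewrite (set_partition_big _ partH) big_enum_val /=; apply: eq_bigr => a _.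
  rewrite !mxE mulr_suml; apply: eq_bigr => v av.
  by congr (_ * _); apply: (orbit_sumE symP).
rewrite /F -mulr_sumr exchange_big mulr_sumr; apply: eq_bigr => u _ /=.
have /matrixP/(_ u 0) := P1; rewrite !mxE => P1u.
rewrite -[RHS]mulr1 -[X in _ = _ * X]P1u; congr (_ * _).
apply: eq_big => [v|v _]; first by rewrite inE.
by rewrite mxE mulr1 {1}PT mxE.
Qed.

(* Main.v *)
(* If a matrix M commutes with the natural representation, then T^* M T commutes
   with the matrices [irreps_mx rho m s], and Schur's lemma applied entrywise to
   its subblocks gives the block form; this covers both P and 11^T/n.  The vector 1
   is fixed by H, so T^* 1 vanishes outside the trivial component i1.  There the
   columns C of T form an orthonormal basis of the space of fixed vectors, as do
   the normalized orbit indicators O.  Hence U = C^* O is unitary with C U = O,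
   and O^T P O and O^T (11^T/n) O are computed by summing over orbits. *)
Require Import Defs.
From HB Require Import structures.
From mathcomp Require Import all_boot all_order all_algebra all_fingroup.
From mathcomp Require Import mxrepresentation.
From mathcomp Require Import reals.
From mathcomp Require Import complex.
From mathcomp Require Import ring.

Set Implicit Arguments.
Unset Strict Implicit.
Unset Printing Implicit Defensive.

Import Order.TTheory GRing.Theory Num.Theory.
Local Open Scope ring_scope.

(** * Schur's lemma and the trivial representation *)

(** The left kernel of [X] is a submodule for [r1] and its row space one for [r2]; irreducibility
    makes a nonzero [X] both injective and surjective. *)
Lemma intertwiner_rsim (K : fieldType) (gT : finGroupType) (H : {group gT})
    n1 n2 (r1 : mx_representation K H n1) (r2 : mx_representation K H n2)
    (X : 'M[K]_(n1, n2)) :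
  mx_irreducible r1 -> mx_irreducible r2 ->
  {in H, forall s, r1 s *m X = X *m r2 s} -> X != 0 -> mx_rsim r1 r2.
Proof.
move=> /mx_irrP[_ irr1] /mx_irrP[_ irr2] hX nzX.
have freeX : row_free X.
  rewrite -kermx_eq0; apply: contraNT nzX => nzk.
  have /irr1/(_ nzk) : mxmodule r1 (kermx X).
    apply/mxmoduleP=> s sH; apply/sub_kermxP.
    by rewrite -mulmxA hX // mulmxA mulmx_ker mul0mx.
  by rewrite -sub1mx => /sub_kermxP; rewrite mul1mx => ->.
have fullX : row_full X.
  have nzg : <<X>>%MS != 0 by rewrite -submx0 genmxE submx0.
  have /irr2/(_ nzg) : mxmodule r2 <<X>>%MS.
    rewrite (eqmx_module _ (genmxE X)); apply/mxmoduleP=> s sH.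
    by rewrite -hX // submxMl.
  by rewrite -!sub1mx genmxE.
by exists X; rewrite // -(eqP freeX) (eqP fullX).
Qed.

(** For an eigenvalue [a] of [X], which exists over a closed field, [X - a%:M] commutes with [r] and
    is singular, so by Schur's lemma it vanishes. *)
Lemma irr_commutant_scalar (K : numClosedFieldType) (gT : finGroupType)
    (H : {group gT}) n (r : mx_representation K H n) (X : 'M[K]_n) :
  mx_irreducible r -> {in H, forall s, r s *m X = X *m r s} ->
  exists a, X = a%:M.
Proof.
move=> irr hX; have /mx_irrP[n_gt0 _] := irr.
have [a /eigenvalueP[v vX nzv]] := eigenvalue_closed X n_gt0.
exists a; apply/eqP; rewrite -subr_eq0; apply: contraNT nzv => nzXa.
have /(mx_Schur irr)/(_ nzXa) uXa : centgmx r (X - a%:M).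
  apply/centgmxP=> s sH.
  by rewrite mulmxBl mulmxBr hX // scalar_mxC.
by rewrite -(mulmxK uXa v) mulmxBr vX mul_mx_scalar subrr mul0mx.
Qed.

Lemma triv_mx_repr (K : fieldType) (gT : finGroupType) (H : {set gT}) :
  mx_repr H (fun _ : gT => 1%:M : 'M[K]_1).
Proof. by split=> // s t _ _; rewrite mulmx1. Qed.

Definition triv_repr (K : fieldType) (gT : finGroupType) (H : {group gT}) :
  mx_representation K H 1 := MxRepresentation (@triv_mx_repr K gT H).

Lemma triv_repr_irr (K : fieldType) (gT : finGroupType) (H : {group gT}) :
  mx_irreducible (triv_repr K H).
Proof. by apply: mx_abs_irrW; apply: linear_mx_abs_irr. Qed.

Lemma rsim_triv_repr (K : fieldType) (gT : finGroupType) (H : {group gT})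
    n (r : mx_representation K H n) :
  mx_rsim (triv_repr K H) r -> {in H, forall s, r s = 1%:M}.
Proof.
case=> B dn freeB hB s sH.
have fullB : row_full B by rewrite /row_full (eqP freeB) -dn.
by apply: (row_full_inj fullB); rewrite -hB //= mul1mx mulmx1.
Qed.

(** * Conjugate transposes and the embedding of real matrices *)

Section Adjoint.

Variable R : realType.

Lemma adjmxM p q r (A : 'M[R[i]]_(p, q)) (B : 'M_(q, r)) :
  adjmx (A *m B) = adjmx B *m adjmx A.
Proof. by rewrite /adjmx trmx_mul map_mxM. Qed.

Lemma adjmxK p q (A : 'M[R[i]]_(p, q)) : adjmx (adjmx A) = A.
Proof. by apply/matrixP => i j; rewrite !mxE conjCK. Qed.

Lemma cmxM p q r (A : 'M[R]_(p, q)) (B : 'M_(q, r)) :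
  cmx (A *m B) = cmx A *m cmx B.
Proof. exact: map_mxM. Qed.

Lemma adjmx_cmx p q (A : 'M[R]_(p, q)) : adjmx (cmx A) = cmx A^T.
Proof.
apply/matrixP => i j; rewrite !mxE; apply: conj_Creal.
by apply/complex_realP; exists (A j i).
Qed.

Lemma cmx_scalar1 p : cmx (1%:M : 'M[R]_p) = 1%:M.
Proof. exact: map_mx1. Qed.

Lemma cmx_natural n (s : 'S_n) : cmx (natural_mx R s) = natural_mx R[i] s.
Proof. by apply/matrixP => i j; rewrite !mxE rmorph_nat. Qed.

(** Moves a change of block size onto the columns that define the block. *)
Lemma castmx_adjmx_congr p q r (eqq : q = r) (X : 'M[R[i]]_(p, q)) (M : 'M_p) :
  castmx (eqq, eqq) (adjmx X *m M *m X) =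
  adjmx (castmx (erefl p, eqq) X) *m M *m castmx (erefl p, eqq) X.
Proof. by case: r / eqq; rewrite !castmx_id. Qed.

End Adjoint.

(** * Block forms and the matrices that commute with the group action *)

Lemma mul_mxdiag (K : pzRingType) p (p_ : 'I_p -> nat)
    (A B : forall i, 'M[K]_(p_ i)) :
  \mxdiag_i A i *m \mxdiag_i B i = \mxdiag_i (A i *m B i).
Proof.
rewrite {2}/mxdiag mul_mxdiag_mxblock; apply: eq_mxblock => i j.
by have [<-|_] := eqVneq i j; rewrite ?mulmx0 // !conform_mx_id.
Qed.

Section BlockForm.

Variables (h : nat) (d m : 'I_h -> nat).

Lemma block_formP (K : nmodType) (B : forall i, 'M[K]_(m i))
    (A : 'M[K]_(\sum_i \sum_(k < d i) m i)) :
  (forall i i', i != i' -> submxblock A i i' = 0) ->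
  (forall i (k k' : 'I_(d i)),
     submxblock (submxblock A i i) k k' = if k == k' then B i else 0) ->
  A = block_form d B.
Proof.
move=> off dia; apply/mxblockP => i i'; rewrite mxblockK.
have [<-|/off//] := eqVneq i i'; rewrite conform_mx_id.
apply/mxblockP => k k'; rewrite dia mxblockK.
by case: eqVneq; rewrite ?conform_mx_id.
Qed.

Lemma submxblock_block_form (K : nmodType) (B : forall i, 'M[K]_(m i)) i
    (k : 'I_(d i)) :
  submxblock (submxblock (block_form d B) i i) k k = B i.
Proof. by rewrite /block_form !submxblock_diag. Qed.

Lemma mul_block_form (K : pzRingType) (B B' : forall i, 'M[K]_(m i)) :
  block_form d B *m block_form d B' = block_form d (fun i => B i *m B' i).
Proof.
by rewrite /block_form mul_mxdiag; apply: eq_mxdiag => i; rewrite mul_mxdiag.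
Qed.

Lemma block_form1 (K : pzRingType) :
  block_form d (fun i => 1%:M : 'M[K]_(m i)) = 1%:M.
Proof.
by rewrite /block_form -[RHS]mxdiagZ; apply: eq_mxdiag => i; rewrite mxdiagZ.
Qed.

Lemma adjmx_block_form (R : realType) (B : forall i, 'M[R[i]]_(m i)) :
  adjmx (block_form d B) = block_form d (fun i => adjmx (B i)).
Proof.
have adj_sub p q (p_ : 'I_p -> nat) (q_ : 'I_q -> nat)
    (M : 'M[R[i]]_(\sum_i p_ i, \sum_i q_ i)) j j' :
  submxblock (adjmx M) j j' = adjmx (submxblock M j' j).
  by apply/matrixP => x y; rewrite !mxE.
apply: block_formP => [i i' ii'|i k k']; rewrite !adj_sub.
  by rewrite mxblockK eq_sym (negbTE ii') /adjmx trmx0 map_mx0.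
rewrite submxblock_diag mxblockK eq_sym.
by case: eqVneq => _; rewrite ?conform_mx_id // /adjmx trmx0 map_mx0.
Qed.

(** The subblocks of [irreps_mx] are scalar matrices, so they commute with every [B i]. *)
Lemma irreps_mx_block_form (K : fieldType) n (H : {group 'S_n})
    (rho : forall i, mx_representation K H (d i)) (B : forall i, 'M[K]_(m i)) s :
  irreps_mx rho m s *m block_form d B = block_form d B *m irreps_mx rho m s.
Proof.
rewrite /irreps_mx /block_form !mul_mxdiag; apply: eq_mxdiag => i.
rewrite mul_mxblock_mxdiag mul_mxdiag_mxblock.
by apply: eq_mxblock => k k'; rewrite scalar_mxC.
Qed.

Lemma basis_cols_block_form (K : pzRingType) n
    (T : 'M[K]_(n, \sum_i \sum_(k < d i) m i)) (B : forall i, 'M[K]_(m i)) i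
    (k : 'I_(d i)) :
  basis_cols (T *m block_form d B) k = basis_cols T k *m B i.
Proof.
rewrite /basis_cols -{1}(submxrowK T) mul_mxrow_mxdiag mxrowK.
by rewrite -{1}(submxrowK (submxrow T i)) mul_mxrow_mxdiag mxrowK.
Qed.

Lemma adjmx_basis_cols_mul (R : realType) n p
    (T : 'M[R[i]]_(n, \sum_i \sum_(k < d i) m i)) (V : 'M_(n, p)) i (k : 'I_(d i)) :
  adjmx (basis_cols T k) *m V = submxcol (submxcol (adjmx T *m V) i) k.
Proof.
rewrite -!submxcol_mul; congr (_ *m _).
by apply/matrixP => x y; rewrite !mxE.
Qed.

Lemma adjmx_basis_cols_congr (R : realType) n
    (T : 'M[R[i]]_(n, \sum_i \sum_(k < d i) m i)) (M : 'M_n)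
    i (k : 'I_(d i)) i' (k' : 'I_(d i')) :
  adjmx (basis_cols T k) *m M *m basis_cols T k' =
  submxblock (submxblock (adjmx T *m M *m T) i i') k k'.
Proof.
rewrite -mulmxA adjmx_basis_cols_mul /basis_cols !mul_submxrow mulmxA.
by apply/matrixP => x y; rewrite !mxE.
Qed.

Lemma natural_mx_basis_cols (K : fieldType) n (H : {group 'S_n})
    (rho : forall i, mx_representation K H (d i))
    (T : 'M[K]_(n, \sum_i \sum_(k < d i) m i)) (s : 'S_n) i (k : 'I_(d i)) :
  natural_mx K s *m T = T *m irreps_mx rho m s ->
  natural_mx K s *m basis_cols T k = \sum_l rho i s^-1%g l k *: basis_cols T l.
Proof.
move=> QT; rewrite /basis_cols !mul_submxrow QT.
rewrite -{1}(submxrowK T) mul_mxrow_mxdiag mxrowK.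
rewrite -{1}(submxrowK (submxrow T i)) mul_mxrow_mxblock mxrowK.
by apply: eq_bigr => l _; rewrite mul_mx_scalar.
Qed.

(** For fixed [j] and [l], the entries of [W] in rows [(i, k, j)] and column [l] form a vector [X]
    indexed by [k]. It intertwines [rho i] with the trivial representation, so it is zero when these
    are inequivalent. *)
Lemma irreps_mx_fixed (K : fieldType) n (H : {group 'S_n}) p
    (rho : forall i, mx_representation K H (d i))
    (W : 'M[K]_(\sum_i \sum_(k < d i) m i, p)) i :
  mx_irreducible (rho i) -> ~ mx_rsim (triv_repr K H) (rho i) ->
  {in H, forall s, irreps_mx rho m s *m W = W} -> submxcol W i = 0.
Proof.
move=> irr ntriv fixW; apply/mxcolP => k; rewrite submxcol0.
apply/matrixP => j l; rewrite mxE.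
pose X := \col_(k < d i) submxcol (submxcol W i) k j l.
have [/matrixP/(_ k 0)|nzX] := eqVneq X 0; first by rewrite !mxE.
case: ntriv; apply: mx_rsim_sym.
apply: (intertwiner_rsim irr (triv_repr_irr _ _)) nzX.
move=> s sH; rewrite mulmx1; apply/colP => k1; rewrite !mxE.
(* The inverse undoes the one in [irreps_mx], leaving [rho i s]. *)
have := fixW s^-1%g (groupVr sH).
rewrite -{1}(submxcolK W) mul_mxdiag_mxcol => /(congr1 (fun Z => submxcol Z i)).
rewrite mxcolK -{1}(submxcolK (submxcol W i)) mul_mxblock_mxrow.
move=> /(congr1 (fun Z => submxcol Z k1 j l)); rewrite mxcolK summxE !mxE => <-.
by apply: eq_bigr => k2 _; rewrite mul_scalar_mx invgK !mxE.
Qed.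

Lemma irreps_mx_commutant (K : numClosedFieldType) n (H : {group 'S_n})
    (rho : forall i, mx_representation K H (d i))
    (A : 'M[K]_(\sum_i \sum_(k < d i) m i)) :
  (forall i, mx_irreducible (rho i)) ->
  (forall i i', mx_rsim (rho i) (rho i') -> i = i') ->
  {in H, forall s, irreps_mx rho m s *m A = A *m irreps_mx rho m s} ->
  exists B, A = block_form d B.
Proof.
move=> irr inj comA.
(* Extracting one entry of every m i x m i' subblock gives an intertwiner. *)
pose X i i' j j' : 'M_(d i, d i') :=
  \matrix_(k, k') submxblock (submxblock A i i') k k' j j'.
have comX i i' j j' :
    {in H, forall s, rho i s *m X i i' j j' = X i i' j j' *m rho i' s}.
  move=> s sH; apply/matrixP => k k'; rewrite !mxE.
  have := comA s^-1%g (groupVr sH).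
  rewrite -(submxblockK A) mul_mxdiag_mxblock mul_mxblock_mxdiag.
  move=> /eq_mxblockP/(_ i i').
  rewrite -(submxblockK (submxblock A i i')) !mul_mxblock => /eq_mxblockP/(_ k k').
  move=> /matrixP/(_ j j'); rewrite !summxE invgK => E.
  transitivity
      (\sum_l ((rho i s k l)%:M *m submxblock (submxblock A i i') l k') j j').
    by apply: eq_bigr => l _; rewrite mul_scalar_mx !mxE.
  by rewrite E; apply: eq_bigr => l _; rewrite mul_mx_scalar !mxE mulrC.
(* Any diagonal subblock will do, since they turn out to be equal; the default 0 is never reached
   because [d i] is positive. *)
pose B i : 'M[K]_(m i) :=
  if [pick k : 'I_(d i)] is Some k then submxblock (submxblock A i i) k k else 0.
exists B; apply: block_formP => [i i' ii'|i k k'].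
  apply/mxblockP => k k'; rewrite submxblock0; apply/matrixP => j j'.
  have [/matrixP/(_ k k')|nzX] := eqVneq (X i i' j j') 0; first by rewrite !mxE.
  by case/eqP: ii'; apply/inj/(intertwiner_rsim (irr i) (irr i') _ nzX)/comX.
apply/matrixP => j j'.
(* At a fixed position [j], [j'], the scalar [a] is the common entry of all diagonal subblocks, and
   the off-diagonal ones have entry 0. *)
have [a /matrixP Xa] := irr_commutant_scalar (irr i) (comX i i j j').
have -> : submxblock (submxblock A i i) k k' j j' = a *+ (k == k').
  by have := Xa k k'; rewrite !mxE.
case: eqVneq => _; last by rewrite mxE.
rewrite /B; case: pickP => [k1 _|/(_ k)//].
by have := Xa k1 k1; rewrite !mxE eqxx.
Qed.

End BlockForm.

(** * The orthonormal basis of normalized orbit indicators *)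

Section OrbitBasis.

Variables (R : realType) (n : nat) (H : {group 'S_n}).

Lemma orbit_atP (a : 'I_#|orbits H|) v :
  v \in orbit_at a -> orbit_at a = orbit 'P H v.
Proof.
have /imsetP[x _ ->] : orbit_at a \in orbits H by apply: enum_valP.
by move/orbit_eqP.
Qed.

Lemma orbit_at_inj v (a b : 'I_#|orbits H|) :
  v \in orbit_at a -> v \in orbit_at b -> a = b.
Proof.
move=> /orbit_atP va /orbit_atP vb; apply: enum_val_inj.
by rewrite -[LHS]/(orbit_at a) va.
Qed.

Lemma orbit_at_ex v : exists a : 'I_#|orbits H|, v \in orbit_at a.
Proof.
have Hv : orbit 'P H v \in orbits H by apply: imset_f.
exists (enum_rank_in Hv (orbit 'P H v)).
by rewrite /orbit_at enum_rankK_in // orbit_refl.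
Qed.

Lemma sqrt_card_orbit_gt0 (a : 'I_#|orbits H|) : 0 < Num.sqrt #|orbit_at a|%:R :> R.
Proof.
have /imsetP[x _ ->] : orbit_at a \in orbits H by apply: enum_valP.
rewrite sqrtr_gt0 ltr0n.
by apply/card_gt0P; exists x; apply: orbit_refl.
Qed.

Lemma sqrt_card_orbitM (a : 'I_#|orbits H|) :
  Num.sqrt #|orbit_at a|%:R * Num.sqrt #|orbit_at a|%:R = #|orbit_at a|%:R :> R.
Proof. by rewrite -expr2 sqr_sqrtr ?ler0n. Qed.

Lemma sum_orbit_basis (a : 'I_#|orbits H|) (F : 'I_n -> R) :
  \sum_v orbit_basis R H v a * F v =
  (\sum_(v in orbit_at a) F v) / Num.sqrt #|orbit_at a|%:R.
Proof.
rewrite mulr_suml [RHS]big_mkcond /=; apply: eq_bigr => v _; rewrite mxE.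
by case: ifP => _; rewrite ?mul0r // mul1r mulrC.
Qed.

Lemma orbit_basis_orthonormal : (orbit_basis R H)^T *m orbit_basis R H = 1%:M.
Proof.
apply/matrixP => a b; rewrite !mxE.
under eq_bigr do rewrite mxE; rewrite sum_orbit_basis.
have [<-|ab] := eqVneq a b.
  rewrite (eq_bigr (fun=> (Num.sqrt #|orbit_at a|%:R)^-1)); last first.
    by move=> v av; rewrite mxE av mul1r.
  rewrite sumr_const -[_^-1 *+ _]mulr_natr.
  (* With [x] the square root of the orbit size, the size becomes [x * x] and only a field identity
     in [x] remains. *)
  move: (sqrt_card_orbitM a) (sqrt_card_orbit_gt0 a).
  by move: (Num.sqrt #|orbit_at a|%:R) => x <- x0; rewrite mulKf ?divff ?gt_eqF.
rewrite big1 ?mul0r ?mxE ?(negbTE ab) // => v av; rewrite mxE.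
case: (boolP (v \in orbit_at b)) => [vb|_]; rewrite ?mul0r //.
by rewrite (orbit_at_inj av vb) eqxx in ab.
Qed.

Lemma natural_mx_mulE (K : pzRingType) p (C : 'M[K]_(n, p)) (s : 'S_n) v l :
  (natural_mx K s *m C) (s v) l = C v l.
Proof.
rewrite mxE (bigD1 v) //= mxE eqxx mul1r big1 ?addr0 // => u uv.
by rewrite mxE (inj_eq perm_inj) eq_sym (negbTE uv) mul0r.
Qed.

Lemma natural_mx_orbit_basis s :
  s \in H -> natural_mx R s *m orbit_basis R H = orbit_basis R H.
Proof.
move=> sH; apply/matrixP => v a; rewrite -{1}(permKV s v) natural_mx_mulE !mxE.
congr ((nat_of_bool _)%:R / _).
have /imsetP[x _ ->] : orbit_at a \in orbits H by apply: enum_valP.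
exact: (actsP (acts_orbit _ _ (subsetT _)) _ (groupVr sH)).
Qed.

(* A fixed vector is constant on orbits, so it lies in the range of the
   isometry [orbit_basis]. *)
Lemma orbit_basis_projK p (C : 'M[R[i]]_(n, p)) :
  {in H, forall s, natural_mx R[i] s *m C = C} ->
  cmx (orbit_basis R H) *m (cmx (orbit_basis R H)^T *m C) = C.
Proof.
move=> fixC; pose O := orbit_basis R H.
pose D : 'M[R[i]]_(#|orbits H|, p) := \matrix_(a, l)
  (real_complex R (Num.sqrt #|orbit_at a|%:R) *
   if [pick v in orbit_at a] is Some v then C v l else 0).
suff -> : C = cmx O *m D.
  by rewrite (mulmxA (cmx O^T)) -cmxM orbit_basis_orthonormal cmx_scalar1 mul1mx.
apply/matrixP => v l; have [a va] := orbit_at_ex v.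
rewrite mxE (bigD1 a) //= big1 ?addr0; last first.
  move=> b ba; rewrite !mxE; case: (boolP (v \in orbit_at b)) => [vb|_].
    by rewrite (orbit_at_inj vb va) eqxx in ba.
  by rewrite mul0r rmorph0 mul0r.
rewrite !mxE va mul1r mulrA -rmorphM mulVf ?gt_eqF ?sqrt_card_orbit_gt0 //.
rewrite rmorph1 mul1r.
case: pickP => [w|/(_ v)]; last by rewrite va.
rewrite (orbit_atP va) => /orbitP[s sH <-].
by have /matrixP/(_ (s v) l) := fixC s sH; rewrite natural_mx_mulE.
Qed.

(** Isolates the factor common to all orbits: it cancels in $\Pi^{1/2}P_H\Pi^{-1/2}$ and squares to
    $1/n$ in $qq^T$. *)
Lemma sqrt_orbit_dist (a : 'I_#|orbits H|) :
  Num.sqrt (orbit_dist R H 0 a) = Num.sqrt #|orbit_at a|%:R * Num.sqrt n%:R^-1.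
Proof. by rewrite mxE sumr_const -[_^-1 *+ _]mulr_natl sqrtrM ?ler0n. Qed.

Lemma orbit_basis_congrE (M : 'M[R]_n) a b :
  ((orbit_basis R H)^T *m M *m orbit_basis R H) a b =
  (\sum_(v in orbit_at a) \sum_(u in orbit_at b) M v u) /
    Num.sqrt #|orbit_at a|%:R / Num.sqrt #|orbit_at b|%:R.
Proof.
rewrite -mulmxA mxE; under eq_bigr do rewrite mxE.
rewrite sum_orbit_basis -mulrA [X in _ = _ * X]mulrC mulrA; congr (_ / _).
rewrite mulr_suml; apply: eq_bigr => v _; rewrite mxE.
by under eq_bigr do rewrite mulrC; rewrite sum_orbit_basis.
Qed.

(** The constant $1/n$ summed over $O\times O'$ is $|O||O'|/n$; normalizing leaves
    $\sqrt{|O|/n}\sqrt{|O'|/n}$. *)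
Lemma orbit_basis_congr_const :
  (orbit_basis R H)^T *m const_mx n%:R^-1 *m orbit_basis R H =
  sqrt_dist R H *m (sqrt_dist R H)^T.
Proof.
apply/matrixP => a b; rewrite orbit_basis_congrE.
transitivity (Num.sqrt (orbit_dist R H 0 a) * Num.sqrt (orbit_dist R H 0 b));
  last by rewrite [RHS]mxE big_ord1 !mxE.
rewrite !sqrt_orbit_dist mulrACA -expr2 sqr_sqrtr ?invr_ge0 ?ler0n //.
under eq_bigr do (under eq_bigr do rewrite mxE); rewrite !sumr_const -!mulrnA.
rewrite -[LHS]mulrA -[in LHS](mulr_natr n%:R^-1) natrM.
move: (sqrt_card_orbitM a) (sqrt_card_orbit_gt0 a).
move: (Num.sqrt #|orbit_at a|%:R) => x <- x0.
move: (sqrt_card_orbitM b) (sqrt_card_orbit_gt0 b).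
move: (Num.sqrt #|orbit_at b|%:R) => y <- y0.
by move: (n%:R^-1) => z; field; rewrite !gt_eqF.
Qed.

(** By symmetry all rows $v\in O$ have the same sum over $O'$, so the double sum is $|O|P_H(O,O')$;
    normalizing leaves $\sqrt{|O|/|O'|}\,P_H(O,O')$. *)
Lemma orbit_basis_congr_symmetric (P : 'M[R]_n) :
  (0 < n)%N -> has_symmetry H P ->
  (orbit_basis R H)^T *m P *m orbit_basis R H =
  Pi_sqrt R H *m orbit_chain H P *m invmx (Pi_sqrt R H).
Proof.
move=> n_gt0 symP; pose f (a : 'I_#|orbits H|) := Num.sqrt (orbit_dist R H 0 a).
have c_gt0 : 0 < Num.sqrt n%:R^-1 :> R by rewrite sqrtr_gt0 invr_gt0 ltr0n.
have f_gt0 a : 0 < f a by rewrite /f sqrt_orbit_dist mulr_gt0 ?sqrt_card_orbit_gt0.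
have PiE : Pi_sqrt R H = diag_mx (\row_a f a).
  by congr diag_mx; apply/rowP => a; rewrite !mxE /f mxE.
(* An explicit right inverse shows that [Pi_sqrt] is invertible, so that [invmx] is a true inverse,
   and also computes it. *)
have PiK : Pi_sqrt R H *m diag_mx (\row_a (f a)^-1) = 1%:M.
  rewrite PiE mulmx_diag -diag_const_mx; congr diag_mx; apply/rowP => a.
  by rewrite !mxE mulfV ?gt_eqF.
have [uPi _] := mulmx1_unit PiK.
have -> : invmx (Pi_sqrt R H) = diag_mx (\row_a (f a)^-1).
  by rewrite -[LHS]mulmx1 -PiK mulKmx.
apply/matrixP => a b; rewrite orbit_basis_congrE PiE mul_diag_mx mul_mx_diag !mxE.
rewrite /f !sqrt_orbit_dist.
rewrite (eq_bigr (fun=> orbit_sum P (orbit_at a) (orbit_at b))); last first.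
  by move=> v av; rewrite -(orbit_sumE symP _ _ av) //; apply: enum_valP.
rewrite sumr_const -[orbit_sum _ _ _ *+ _]mulr_natr.
move: (sqrt_card_orbitM a) (sqrt_card_orbit_gt0 a).
move: (Num.sqrt #|orbit_at a|%:R) => x <- x0.
move: (sqrt_card_orbit_gt0 b); move: (Num.sqrt #|orbit_at b|%:R) => y y0.
move: (orbit_sum _ _ _) (Num.sqrt n%:R^-1) c_gt0 => z c c0.
by field; rewrite !gt_eqF.
Qed.

End OrbitBasis.

(** * Symmetry-adapted bases and the trivial isotypic component *)

Section SymmetryAdapted.

Variables (R : realType) (n : nat) (H : {group 'S_n}).
Variables (h : nat) (d m : 'I_h -> nat).
Variables (rho : forall i : 'I_h, mx_representation R[i] H (d i)).
Variable T : 'M[R[i]]_(n, \sum_i \sum_(k < d i) m i).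
Hypothesis irrho : forall i, mx_irreducible (rho i).
Hypothesis injrho : forall i i', mx_rsim (rho i) (rho i') -> i = i'.
Hypothesis adT : symmetry_adapted rho T.

Lemma adjmx_symmetry_adapted s : s \in H ->
  irreps_mx rho m s *m adjmx T = adjmx T *m natural_mx R[i] s.
Proof.
move=> sH; have [T1 T2 QT] := adT.
rewrite -[LHS]mul1mx -T1 -mulmxA (mulmxA T) -(QT s sH) -(mulmxA _ T) T2.
by rewrite mulmx1.
Qed.

Lemma symmetry_adapted_block_form (M : 'M[R[i]]_n) :
  {in H, forall s, natural_mx R[i] s *m M = M *m natural_mx R[i] s} ->
  exists B, adjmx T *m M *m T = block_form d B.
Proof.
move=> comM; apply: (irreps_mx_commutant irrho injrho) => s sH.
have [_ _ /(_ s sH) QT] := adT.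
rewrite !mulmxA adjmx_symmetry_adapted // -(mulmxA _ _ M) comM // mulmxA.
by rewrite -(mulmxA (adjmx T *m M)) QT mulmxA.
Qed.

Lemma block_form_basis_cols (M : 'M[R[i]]_n) B i (k : 'I_(d i)) :
  adjmx T *m M *m T = block_form d B ->
  B i = adjmx (basis_cols T k) *m M *m basis_cols T k.
Proof. by move=> E; rewrite adjmx_basis_cols_congr E submxblock_block_form. Qed.

Variable i1 : 'I_h.
Hypothesis trivial_i1 : mx_rsim (triv_repr R[i] H) (rho i1).

(** [adjmx T *m V] is fixed by the matrices [irreps_mx], and by inequivalence only [rho i1] is
    trivial. *)
Lemma fixed_isotypic_eq0 p (V : 'M[R[i]]_(n, p)) i :
  {in H, forall s, natural_mx R[i] s *m V = V} -> i != i1 ->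
  submxcol (adjmx T *m V) i = 0.
Proof.
move=> fixV ii1; apply: (irreps_mx_fixed (irrho i)) => [sim_i|s sH].
  by case/eqP: ii1; apply/injrho/mx_rsim_trans/trivial_i1/mx_rsim_sym.
by rewrite mulmxA adjmx_symmetry_adapted // -(mulmxA (adjmx T)) fixV.
Qed.

(** [d i1] equals 1 only propositionally; uniqueness of the index avoids transporting [rho] and [T]
    along that equality. *)
Lemma trivial_index_eq (k k' : 'I_(d i1)) : k = k'.
Proof.
move: k k'; rewrite -(mxrank_rsim trivial_i1) => k k'.
by rewrite [k]ord1 [k']ord1.
Qed.

Variable k0 : 'I_(d i1).
Let C := basis_cols T k0.

Lemma trivial_basis_cols_fixed : {in H, forall s, natural_mx R[i] s *m C = C}.
Proof.
move=> s sH; have [_ _ /(_ s sH) QT] := adT.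
rewrite (natural_mx_basis_cols _ QT) (big_pred1 k0) => [|l]; last first.
  by rewrite /= (trivial_index_eq l k0) eqxx.
by rewrite (rsim_triv_repr trivial_i1) ?groupV // mxE eqxx scale1r.
Qed.

Lemma trivial_basis_cols_orthonormal : adjmx C *m C = 1%:M.
Proof.
have [T1 _ _] := adT; rewrite -[adjmx C]mulmx1.
(* The Gram matrix of [C] is a diagonal subblock of [adjmx T *m T], the identity seen as a block
   form. *)
rewrite -(@block_form_basis_cols _ (fun i => 1%:M)) //.
by rewrite mulmx1 T1 block_form1.
Qed.

(** Expand [V] as [T *m (adjmx T *m V)]: only the component [i1] contributes, and it has the single
    index [k0]. *)
Lemma trivial_basis_cols_projK p (V : 'M[R[i]]_(n, p)) :
  {in H, forall s, natural_mx R[i] s *m V = V} -> C *m (adjmx C *m V) = V.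
Proof.
move=> fixV; have [_ T2 _] := adT.
rewrite adjmx_basis_cols_mul -[RHS]mul1mx -T2 -[RHS]mulmxA /C /basis_cols.
set Z := adjmx T *m V.
rewrite -{2}(submxrowK T) -{2}(submxcolK Z) mul_mxrow_mxcol.
rewrite [RHS](bigD1 i1) //= [X in _ + X]big1 ?addr0 => [|i ii1]; last first.
  by rewrite fixed_isotypic_eq0 ?mulmx0.
rewrite -{2}(submxrowK (submxrow T i1)) -{2}(submxcolK (submxcol Z i1)).
rewrite mul_mxrow_mxcol [RHS](big_pred1 k0) // => l.
by rewrite /= (trivial_index_eq l k0) eqxx.
Qed.

Let U0 := adjmx C *m cmx (orbit_basis R H).

Lemma orbit_basis_fixed s :
  s \in H -> natural_mx R[i] s *m cmx (orbit_basis R H) = cmx (orbit_basis R H).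
Proof. by move=> sH; rewrite -cmx_natural -cmxM natural_mx_orbit_basis. Qed.

Lemma trivial_basis_colsE : C *m U0 = cmx (orbit_basis R H).
Proof. exact/trivial_basis_cols_projK/orbit_basis_fixed. Qed.

(** The first identity holds because the orbit basis lies in the range of [C], the second because
    [C] lies in the range of the orbit basis. [U0] is still rectangular here. *)
Lemma trivial_change_unitary : adjmx U0 *m U0 = 1%:M /\ U0 *m adjmx U0 = 1%:M.
Proof.
split.
  rewrite {1}/U0 adjmxM adjmxK -mulmxA trivial_basis_colsE adjmx_cmx -cmxM.
  by rewrite orbit_basis_orthonormal cmx_scalar1.
rewrite /U0 adjmxM adjmxK adjmx_cmx -mulmxA.
rewrite (orbit_basis_projK trivial_basis_cols_fixed).
exact: trivial_basis_cols_orthonormal.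
Qed.

(** Each of the two identities for [U0] bounds one of its dimensions by the other. *)
Lemma trivial_multiplicity : m i1 = #|orbits H|.
Proof.
have [U1 U2] := trivial_change_unitary.
by apply/eqP; rewrite eqn_leq (mulmx1_min U1) (mulmx1_min U2).
Qed.

(** [W i] mixes the [m i] copies of [rho i] in the same way for every [k], which preserves the
    transformation law. *)
Lemma symmetry_adapted_mul (W : forall i, 'M[R[i]]_(m i)) :
  (forall i, adjmx (W i) *m W i = 1%:M) ->
  symmetry_adapted rho (T *m block_form d W).
Proof.
move=> W1; have [T1 T2 QT] := adT.
have W2 i : W i *m adjmx (W i) = 1%:M by apply: mulmx1C.
have eqbf (B B' : forall i, 'M[R[i]]_(m i)) :
    (forall i, B i = B' i) -> block_form d B = block_form d B'.
  by move=> BB'; do 2![apply: eq_mxdiag => ?].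
split=> [||s sH].
- rewrite adjmxM mulmxA -(mulmxA _ (adjmx T)) T1 mulmx1 adjmx_block_form.
  by rewrite mul_block_form (eqbf _ _ W1) block_form1.
- rewrite adjmxM mulmxA -(mulmxA T) adjmx_block_form.
  by rewrite mul_block_form (eqbf _ _ W2) block_form1 mulmx1.
by rewrite mulmxA QT // -[LHS]mulmxA irreps_mx_block_form mulmxA.
Qed.

End SymmetryAdapted.

(** * Matching sizes, constant matrices, and the blocks of the theorem *)

(** Once [eqq] is eliminated, [U0] is square and serves as [U]. *)
Lemma unitary_castmx (R : realType) p q r (eqq : q = r) (C : 'M[R[i]]_(p, q))
    (U0 : 'M_(q, r)) :
  adjmx U0 *m U0 = 1%:M -> U0 *m adjmx U0 = 1%:M ->
  exists U : 'M_q, [/\ adjmx U *m U = 1%:M, U *m adjmx U = 1%:M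
    & castmx (erefl p, eqq) (C *m U) = C *m U0].
Proof. by case: r / eqq U0 => U0; exists U0; rewrite castmx_id. Qed.

Lemma natural_mx_const (K : pzRingType) n (a : K) (s : 'S_n) p :
  natural_mx K s *m const_mx a = const_mx a :> 'M_(n, p).
Proof.
by apply/matrixP => v l; rewrite -(permKV s v) natural_mx_mulE !mxE.
Qed.

Lemma const_natural_mx (K : pzRingType) n (a : K) (s : 'S_n) p :
  const_mx a *m natural_mx K s = const_mx a :> 'M_(p, n).
Proof.
apply/matrixP => l v; rewrite !mxE (bigD1 (s v)) //= !mxE eqxx mulr1.
by rewrite big1 ?addr0 // => u /negbTE uv; rewrite !mxE uv mulr0.
Qed.

Theorem theorem5p1 (R : realType) (n : nat) (e : rel 'I_n) (H : {group 'S_n})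
    (h : nat) (d : 'I_h -> nat)
    (rho : forall i : 'I_h, mx_representation R[i] H (d i))
    (m : 'I_h -> nat)
    (T : 'M[R[i]]_(n, \sum_i \sum_(k < d i) m i))
    (P : 'M[R]_n) :
  (0 < n)%N ->
  symmetric e ->
  (forall x y : 'I_n, connect e x y) ->
  H \subset Aut_graph e ->
  complete_irreps rho ->
  symmetry_adapted rho T ->
  markov_chain_on e P ->
  has_symmetry H P ->
  exists (B J : forall i : 'I_h, 'M[R[i]]_(m i)) (i1 : 'I_h)
         (eqm : m i1 = #|orbits H|),
    let BH : 'M[R[i]]_#|orbits H| :=
      cmx (Pi_sqrt R H *m orbit_chain H P *m invmx (Pi_sqrt R H)) in
    let JH : 'M[R[i]]_#|orbits H| :=
      cmx (sqrt_dist R H *m (sqrt_dist R H)^T) in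
    (* the common block diagonal form *)
    [/\ adjmx T *m cmx P *m T = block_form d B,
        adjmx T *m (n%:R^-1 *: (const_mx 1 *m (const_mx 1 : 'cV[R[i]]_n)^T)) *m T
          = block_form d J,
    (* only one nonzero block *)
        [/\ d i1 = 1%N, J i1 != 0 & forall i, i != i1 -> J i = 0],
    (* T uses the normalized orbit indicators in the component i1 *)
        (forall k : 'I_(d i1),
           castmx (erefl n, eqm) (basis_cols T k) = cmx (orbit_basis R H)) ->
        castmx (eqm, eqm) (B i1) = BH /\ castmx (eqm, eqm) (J i1) = JH
    (* arbitrary T: it becomes such a basis after a unitary change of basis U
       in the component i1 *)
      & exists (U : 'M[R[i]]_(m i1)) (T' : 'M[R[i]]_(n, \sum_i \sum_(k < d i) m i)),
        [/\ adjmx U *m U = 1%:M /\ U *m adjmx U = 1%:M,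
            symmetry_adapted rho T',
            forall i (k : 'I_(d i)), i != i1 -> basis_cols T' k = basis_cols T k,
            forall k : 'I_(d i1),
              basis_cols T' k = basis_cols T k *m U /\
              castmx (erefl n, eqm) (basis_cols T' k) = cmx (orbit_basis R H)
          & castmx (eqm, eqm) (adjmx U *m B i1 *m U) = BH /\
            castmx (eqm, eqm) (adjmx U *m J i1 *m U) = JH]].
Proof.
move=> n_gt0 _ _ _ [irr inj compl] adT _ symP.
(* The distinguished component is that of the trivial representation, which a complete list
   contains. *)
have [i1 triv_i1] := compl 1%N _ (triv_repr_irr R[i] H).
have k0 : 'I_(d i1) by rewrite -(mxrank_rsim triv_i1); apply: ord0.
have allk k : k = k0 := trivial_index_eq triv_i1 k k0.
pose M : 'M[R[i]]_n := const_mx n%:R^-1.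
have ME : n%:R^-1 *: (const_mx 1 *m (const_mx 1 : 'cV[R[i]]_n)^T) = M.
  by apply/matrixP => u v; rewrite !mxE big_ord1 !mxE !mulr1.
have cM : cmx (const_mx n%:R^-1 : 'M[R]_n) = M.
  by rewrite /cmx map_const_mx fmorphV rmorph_nat.
have fixM : {in H, forall s, natural_mx R[i] s *m M = M}.
  by move=> s _; apply: natural_mx_const.
have [B BE] : exists B, adjmx T *m cmx P *m T = block_form d B.
  apply: (symmetry_adapted_block_form irr inj adT) => s sH.
  by rewrite -cmx_natural -!cmxM symP.
have [J JE] : exists J, adjmx T *m M *m T = block_form d J.
  apply: (symmetry_adapted_block_form irr inj adT) => s sH.
  by rewrite fixM // const_natural_mx.
have J0 i : i != i1 -> J i = 0.
  (* As [d i] is positive, [J i] occurs as a subblock; the columns of [M] are fixed vectors, so that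
     subblock is zero. *)
  move=> ii1; have /mx_irrP[di_gt0 _] := irr i.
  rewrite (block_form_basis_cols (Ordinal di_gt0) JE) adjmx_basis_cols_mul.
  by rewrite (fixed_isotypic_eq0 irr inj adT triv_i1 fixM ii1) submxcol0 mul0mx.
have eqm := trivial_multiplicity irr inj adT triv_i1 k0.
(* Stated for arbitrary columns [X], to serve both the case where [T] already uses the orbit
   indicators and the modified basis. *)
have congrE (X : 'M_(n, m i1)) :
    castmx (erefl n, eqm) X = cmx (orbit_basis R H) ->
    castmx (eqm, eqm) (adjmx X *m cmx P *m X) =
      cmx (Pi_sqrt R H *m orbit_chain H P *m invmx (Pi_sqrt R H)) /\
    castmx (eqm, eqm) (adjmx X *m M *m X) =
      cmx (sqrt_dist R H *m (sqrt_dist R H)^T).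
  move=> XE; rewrite !castmx_adjmx_congr XE adjmx_cmx -cM -!cmxM.
  by rewrite orbit_basis_congr_symmetric // orbit_basis_congr_const.
have BC := block_form_basis_cols k0 BE; have JC := block_form_basis_cols k0 JE.
exists B, J, i1, eqm => BH JH; split; first exact: BE.
- by rewrite ME.
- split=> //; first by rewrite -(mxrank_rsim triv_i1).
  (* Otherwise every block would vanish, and unitarity of [T] would give [M = 0], although its
     entries are $1/n$. *)
  apply/eqP => Ji1; have [T1 T2 _] := adT.
  have Z : block_form d J = 0.
    rewrite -[RHS]mxdiag0; apply: eq_mxdiag => i; rewrite -[RHS]mxdiag0.
    by apply: eq_mxdiag => _; have [->|/J0] := eqVneq i i1.
  have /matrixP/(_ (Ordinal n_gt0) (Ordinal n_gt0)) : M = 0.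
    rewrite -[M]mul1mx -[M]mulmx1 -T2 !mulmxA -(mulmxA T) -(mulmxA T) JE Z.
    by rewrite mulmx0 mul0mx.
  by rewrite !mxE => /eqP; rewrite invr_eq0 pnatr_eq0 eqn0Ngt n_gt0.
- by move=> /(_ k0) /congrE; rewrite -BC -JC.
have [U1 U2] := trivial_change_unitary irr inj adT triv_i1 k0.
have [U [UU UU' CU]] := unitary_castmx eqm (basis_cols T k0) U1 U2.
rewrite (trivial_basis_colsE irr inj adT triv_i1 k0) in CU.
(* Change the basis by [U] in the component [i1] only; [conform_mx] reconciles the sizes [m i] and
   [m i1]. *)
pose W i : 'M[R[i]]_(m i) := if i == i1 then conform_mx 1%:M U else 1%:M.
have Wi1 : W i1 = U by rewrite /W eqxx conform_mx_id.
exists U, (T *m block_form d W); split; first by [].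
- apply: symmetry_adapted_mul => // i.
  have [->|ii1] := eqVneq i i1; first by rewrite Wi1.
  by rewrite /W (negbTE ii1) mulmx1 /adjmx trmx1 map_mx1.
- by move=> i k ii1; rewrite basis_cols_block_form /W (negbTE ii1) mulmx1.
- by move=> k; rewrite (allk k) basis_cols_block_form Wi1.
have := congrE _ CU; rewrite adjmxM BC JC !mulmxA; exact.
Qed.
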